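(* Let $\mu\ge 1$, let $p,q$ be coprime positive integers, and let $L=T(\mu p,\mu q)\subset S^3$ be the $\mu$-component torus link with link group $G(L)$. Let $\rho:G(L)\to \mathrm{SL}(2,\mathbb{C})$ be an irreducible representation, put $X=\rho(x)$, $Y=\rho(y)$, and let $a,b$ be integers with $0\le a\le p$, $0\le b\le q$ such that, with $\alpha=\exp(\sqrt{-1}\,\pi a/p)$ and $\beta=\exp(\sqrt{-1}\,\pi b/q)$, $X$ is conjugate to $\begin{pmatrix}\alpha&0\\0&\alpha^{-1}\end{pmatrix}$ and $Y$ is conjugate to $\begin{pmatrix}\beta&0\\0&\beta^{-1}\end{pmatrix}$. Then the twisted Alexander polynomial of $L$ associated to $\rho$ is given (up to its usual indeterminacy, multiplication by $t_1^{2k_1}\cdots t_\mu^{2k_\mu}$ with $k_j\in\mathbb{Z}$) by $$\Delta_{L,\rho}(t_1,\ldots,t_\mu)=\frac{\big(t^{pq}-(-1)^a\big)^{2\mu}}{(t^p-\beta)(t^p-\beta^{-1})(t^q-\alpha)(t^q-\alpha^{-1})},\qquad t=t_1\cdots t_\mu .$$ Moreover, every coefficient of $\Delta_{L,\rho}(t_1,\ldots,t_\mu)$ is locally constant on the irreducible character variety $\mathcal{X}(\mu p,\mu q)$.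
   Context: Link group. $G(L)=\pi_1(S^3\setminus \mathrm{int}\,N(L))$, where $N(L)$ is a closed tubular neighbourhood of $L$. For $L=T(\mu p,\mu q)$ it has the presentation $$G(L)=\langle m_1,\ldots,m_\mu,x,y,\ell\mid m_\mu m_{\mu-1}\cdots m_1=x^ry^s,\ [\ell,m_i]=1\ (1\le i\le\mu),\ \ell=x^p=y^q\rangle ,$$ where $r,s$ are integers with $ps+qr=1$, $x,y$ represent the cores of the two solid tori of the genus one Heegaard splitting of $S^3$ given by the standard torus containing $L$, $\ell$ represents a parallel of the torus knot $T(p,q)$ on that torus, and $m_i$ is a meridian of the $i$-th component. Eliminating $m_\mu$ and $\ell$ it reduces to $$G(L)=\langle m_1,\ldots,m_{\mu-1},x,y\mid [x^p,m_i]=1\ (1\le i\le \mu-1),\ x^p=y^q\rangle .$$ The abelianization $\alpha_L:G(L)\to H_1(S^3\setminus \mathrm{int}\,N(L);\mathbb{Z})\cong\langle t_1\rangle\oplus\cdots\oplus\langle t_\mu\rangle\cong\mathbb{Z}^{\mu}$ (written multiplicatively) is $\alpha_L(m_i)=t_i$, $\alpha_L(x)=t^q$, $\alpha_L(y)=t^p$, with $t=t_1\cdots t_\mu$. Twisted Alexander polynomial (Wada). Let $G(L)=\langle x_1,\ldots,x_l\mid r_1,\ldots,r_{l-1}\rangle$ be a presentation with one fewer relator than generators (e.g. a Wirtinger presentation or the reduced one above), $F_l$ the free group on $x_1,\dots,x_l$, and $\rho:G(L)\to\mathrm{SL}(2,\mathbb{C})$ a representation. Let $\Phi:\mathbb{Z}[F_l]\to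 M(2,\mathbb{C}[t_1^{\pm1},\ldots,t_\mu^{\pm1}])$ be the composition of the projection $\mathbb{Z}[F_l]\to\mathbb{Z}[G(L)]$ with the ring homomorphism determined by $g\mapsto \alpha_L(g)\rho(g)$. Let $A$ be the $(l-1)\times l$ matrix whose $(i,j)$ entry is the $2\times2$ block $\Phi(\partial r_i/\partial x_j)$ (free differential), and let $A_j$ be $A$ with its $j$-th block column removed, regarded as a $2(l-1)\times2(l-1)$ matrix. Then $\Delta_{L,\rho}(t_1,\ldots,t_\mu)=\det A_j/\det\Phi(x_j-1)$ (for any $j$ with nonzero denominator), a rational function well defined up to multiplication by $t_1^{2k_1}\cdots t_\mu^{2k_\mu}$, $k_j\in\mathbb{Z}$, independent of the choice of presentation and of $\rho$ within its conjugacy class. Character variety. $\rho$ is irreducible if $\mathbb{C}^2$ has no nontrivial proper $\rho(G(L))$-invariant subspace. $\mathcal{R}(\mu p,\mu q)$ is the set of irreducible representations $G(L)\to\mathrm{SL}(2,\mathbb{C})$, topologized as a subspace of $\mathrm{SL}(2,\mathbb{C})^{\mu+1}$ via the images of $m_1,\dots,m_{\mu-1},x,y$, and $\mathcal{X}(\mu p,\mu q)$ is its quotient by conjugation by $\mathrm{SL}(2,\mathbb{C})$. Local constancy of the coefficients means that every point of $\mathcal{X}(\mu p,\mu q)$ has a neighbourhood on which $\Delta_{L,\rho}$, as a class modulo the stated indeterminacy, does not vary. *)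

(* Defs.v *)
From HB Require Import structures.
From mathcomp Require Import all_boot all_order all_algebra.
From mathcomp Require Import all_classical all_reals all_analysis.
From mathcomp Require Import complex.
From mathcomp Require Import -(notations) mpoly.

Set Implicit Arguments.
Unset Strict Implicit.
Unset Printing Implicit Defensive.

Import Order.TTheory GRing.Theory Num.Theory.
Import numFieldNormedType.Exports.

Local Open Scope ring_scope.
Local Open Scope quotient_scope.
Local Open Scope classical_set_scope.

(* Words in the letters x_i^{+1}, x_i^{-1}: the letter x_i is (i, false) and
   its inverse is (i, true). Words need not be reduced. *)
Definition word (I : Type) := seq (I * bool).
HB.instance Definition _ (I : choiceType) := Choice.on (word I).

Definition inv_letter (I : Type) (a : I * bool) : I * bool := (a.1, ~~ a.2).
Definition inv_word (I : Type) (w : word I) : word I :=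
  rev (map (@inv_letter I) w).
Definition pow_word (I : Type) (i : I) (n : nat) : word I := nseq n (i, false).

Section Presentation.
Variables (I : choiceType) (J : Type) (rels : J -> word I).

Inductive pres_eqv : word I -> word I -> Prop :=
| Pres_refl w : pres_eqv w w
| Pres_sym v w : pres_eqv v w -> pres_eqv w v
| Pres_trans u v w : pres_eqv u v -> pres_eqv v w -> pres_eqv u w
| Pres_cancel u a v : pres_eqv (u ++ [:: a; inv_letter a] ++ v) (u ++ v)
| Pres_rel u j v : pres_eqv (u ++ rels j ++ v) (u ++ v).

Definition pres_rel : rel (word I) := fun v w => `[< pres_eqv v w >].

Lemma pres_rel_equiv : equiv_class_of pres_rel.
Proof.
split=> [w|v w|v u w]; first exact/asboolP/Pres_refl.
  by apply/asboolP/asboolP; exact: Pres_sym.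
by move=> /asboolP h1 /asboolP h2; apply/asboolP; exact: Pres_trans h1 h2.
Qed.
Canonical pres_equiv := EquivRelPack pres_rel_equiv.

(* The group < x_i, i in I | rels j, j in J >. *)
Definition pres_group := {eq_quot pres_equiv}.
HB.instance Definition _ := Choice.on pres_group.
HB.instance Definition _ := EqQuotient.on pres_group.

Definition wclass (w : word I) : pres_group := \pi w.
Definition gen (i : I) : pres_group := wclass [:: (i, false)].

Lemma wclassP v w : wclass v = wclass w <-> pres_eqv v w.
Proof.
rewrite /wclass; split=> [/eqmodP/asboolP //|h].
by apply/eqmodP/asboolP.
Qed.

Lemma wclass_repr (g : pres_group) : wclass (repr g) = g.
Proof. exact: reprK. Qed.

Lemma pres_eqv_ctx s t v w :
  pres_eqv v w -> pres_eqv (s ++ v ++ t) (s ++ w ++ t).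
Proof.
elim=> [u|u u' _ h|u u' u'' _ h _ h'|u a u'|u j u'].
- exact: Pres_refl.
- exact: Pres_sym.
- exact: Pres_trans h h'.
- have := Pres_cancel (s ++ u) a (u' ++ t); by rewrite -!catA.
- have := Pres_rel (s ++ u) j (u' ++ t); by rewrite -!catA.
Qed.

Lemma pres_eqv_cat v v' w w' :
  pres_eqv v v' -> pres_eqv w w' -> pres_eqv (v ++ w) (v' ++ w').
Proof.
move=> hv hw; apply: (@Pres_trans _ (v' ++ w)).
  exact: (@pres_eqv_ctx [::] w _ _ hv).
by have := @pres_eqv_ctx v' [::] _ _ hw; rewrite !cats0.
Qed.

Lemma inv_letterK : involutive (@inv_letter I).
Proof. by case=> i b; rewrite /inv_letter /= negbK. Qed.

Lemma inv_wordK : involutive (@inv_word I).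
Proof.
by move=> w; rewrite /inv_word map_rev revK -map_comp map_id_in// => a _; exact: inv_letterK.
Qed.

Lemma inv_word_cat (v w : word I) : inv_word (v ++ w) = inv_word w ++ inv_word v.
Proof. by rewrite /inv_word map_cat rev_cat. Qed.

Lemma pres_eqv_mulV w : pres_eqv (w ++ inv_word w) [::].
Proof.
elim: w => [|a w ih]; first exact: Pres_refl.
rewrite -[a :: w]cat1s inv_word_cat -!catA.
apply: (@Pres_trans _ ([:: a] ++ [::] ++ inv_word [:: a])).
  by have := @pres_eqv_ctx [:: a] (inv_word [:: a]) _ _ ih; rewrite -!catA.
exact: (Pres_cancel [::] a [::]).
Qed.

Lemma pres_eqv_mulVl w : pres_eqv (inv_word w ++ w) [::].
Proof. by have := pres_eqv_mulV (inv_word w); rewrite inv_wordK. Qed.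

Lemma pres_eqv_inv v w : pres_eqv v w -> pres_eqv (inv_word v) (inv_word w).
Proof.
move=> h; apply: (@Pres_trans _ (inv_word v ++ (w ++ inv_word w))).
  apply: Pres_sym; rewrite -[X in pres_eqv _ X]cats0.
  by apply: pres_eqv_cat; [exact: Pres_refl | exact: pres_eqv_mulV].
rewrite catA -[X in pres_eqv _ X]cat0s.
apply: pres_eqv_cat; last exact: Pres_refl.
apply: Pres_trans (pres_eqv_mulVl v); apply: pres_eqv_cat; first exact: Pres_refl.
exact: Pres_sym.
Qed.

Definition pres_mul (g h : pres_group) : pres_group :=
  wclass (repr g ++ repr h).
Definition pres_inv (g : pres_group) : pres_group := wclass (inv_word (repr g)).

Lemma pres_mulE v w : pres_mul (wclass v) (wclass w) = wclass (v ++ w).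
Proof. by apply/wclassP/pres_eqv_cat; apply/wclassP; rewrite wclass_repr. Qed.

Lemma pres_invE v : pres_inv (wclass v) = wclass (inv_word v).
Proof. by apply/wclassP/pres_eqv_inv/wclassP; rewrite wclass_repr. Qed.

Lemma pres_mulA : associative pres_mul.
Proof.
move=> f g h; rewrite -(wclass_repr f) -(wclass_repr g) -(wclass_repr h).
by rewrite !pres_mulE catA.
Qed.
Lemma pres_mul1 : left_id (wclass [::]) pres_mul.
Proof. by move=> g; rewrite -(wclass_repr g) pres_mulE. Qed.
Lemma pres_1mul : right_id (wclass [::]) pres_mul.
Proof. by move=> g; rewrite -(wclass_repr g) pres_mulE cats0. Qed.
Lemma pres_mulV : left_inverse (wclass [::]) pres_inv pres_mul.
Proof.
move=> g; rewrite -(wclass_repr g) pres_invE pres_mulE.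
exact/wclassP/pres_eqv_mulVl.
Qed.
Lemma pres_Vmul : right_inverse (wclass [::]) pres_inv pres_mul.
Proof.
move=> g; rewrite -(wclass_repr g) pres_invE pres_mulE.
exact/wclassP/pres_eqv_mulV.
Qed.

HB.instance Definition _ :=
  isGroup.Build pres_group pres_mulA pres_mul1 pres_1mul pres_mulV pres_Vmul.

Section Lift.
Variables (H : groupType) (f : I -> H).

Definition eval_word (w : word I) : H :=
  foldr (fun a h => (if a.2 then (f a.1)^-1 else f a.1) * h)%g 1%g w.

Definition pres_lift (g : pres_group) : H := eval_word (repr g).

Lemma eval_word_cat v w : eval_word (v ++ w) = (eval_word v * eval_word w)%g.
Proof. by elim: v => [|a v ih] /=; rewrite ?mul1g // ih mulgA. Qed.

Lemma eval_word_inv w : eval_word (inv_word w) = (eval_word w)^-1%g.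
Proof.
elim: w => [|[i b] w ih]; first by rewrite invg1.
rewrite -[_ :: w]cat1s inv_word_cat !eval_word_cat ih invgM; congr (_ * _)%g.
by case: b; rewrite /= !mulg1 ?invgK.
Qed.

Lemma eval_word_pow i n : eval_word (pow_word i n) = (f i ^+ n)%g.
Proof. by elim: n => [|n ih] //=; rewrite ih expgS. Qed.

Hypothesis f_rels : forall j, eval_word (rels j) = 1%g.

Lemma eval_word_eqv v w : pres_eqv v w -> eval_word v = eval_word w.
Proof.
elim=> // [u u' u'' _ -> _ -> //|u [i b] u'|u j u'];
  rewrite !eval_word_cat; last by rewrite f_rels mul1g.
congr (_ * _)%g; case: b => /=; rewrite mulg1 ?mulVg ?mulgV mul1g //.
Qed.

Lemma pres_liftE w : pres_lift (wclass w) = eval_word w.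
Proof. by apply/eval_word_eqv/wclassP; rewrite wclass_repr. Qed.

Lemma pres_lift_gen i : pres_lift (gen i) = f i.
Proof. by rewrite pres_liftE /= mulg1. Qed.

Lemma pres_liftM : {morph pres_lift : g h / (g * h)%g}.
Proof.
move=> g h; rewrite -(wclass_repr g) -(wclass_repr h).
rewrite -[(_ * _)%g]/(pres_mul _ _) pres_mulE !pres_liftE.
exact: eval_word_cat.
Qed.
End Lift.
End Presentation.

Section SL2.
Variable C : fieldType.

Record SL2 := MkSL2 { sl2_mx :> 'M[C]_2; _ : \det sl2_mx == 1 }.
HB.instance Definition _ := [isSub for sl2_mx].
HB.instance Definition _ := [Choice of SL2 by <:].

Lemma sl2_det (A : SL2) : \det A = 1. Proof. exact/eqP/(valP A). Qed.
Lemma sl2_unit (A : SL2) : sl2_mx A \in unitmx.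
Proof. by rewrite unitmxE sl2_det unitr1. Qed.

Lemma sl2_1P : \det (1%:M : 'M[C]_2) == 1. Proof. by rewrite det1. Qed.
Lemma sl2_mulP (A B : SL2) : \det (A *m B) == 1.
Proof. by rewrite det_mulmx !sl2_det mulr1. Qed.
Lemma sl2_invP (A : SL2) : \det (invmx A) == 1.
Proof. by rewrite det_inv sl2_det invr1. Qed.

Definition sl2_one := MkSL2 sl2_1P.
Definition sl2_mul A B := MkSL2 (sl2_mulP A B).
Definition sl2_inv A := MkSL2 (sl2_invP A).

Lemma sl2_mulA : associative sl2_mul.
Proof. by move=> A B D; apply: val_inj; exact: mulmxA. Qed.
Lemma sl2_mul1 : left_id sl2_one sl2_mul.
Proof. by move=> A; apply: val_inj; exact: mul1mx. Qed.
Lemma sl2_1mul : right_id sl2_one sl2_mul.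
Proof. by move=> A; apply: val_inj; exact: mulmx1. Qed.
Lemma sl2_mulV : left_inverse sl2_one sl2_inv sl2_mul.
Proof. by move=> A; apply: val_inj; exact: mulVmx (sl2_unit A). Qed.
Lemma sl2_Vmul : right_inverse sl2_one sl2_inv sl2_mul.
Proof. by move=> A; apply: val_inj; exact: mulmxV (sl2_unit A). Qed.

HB.instance Definition _ :=
  isGroup.Build SL2 sl2_mulA sl2_mul1 sl2_1mul sl2_mulV sl2_Vmul.
End SL2.

(* An element of Z[F], F free on I, as a formal sum of signed words:
   s stands for \sum_(c <- s) c.1 * c.2. *)
Definition free_ring (I : Type) := seq (int * word I).

(* Free differential d/dx_j, from d(a w) = da + a dw,
   dx_j = 1, d(x_j^-1) = - x_j^-1. *)
Definition fox_letter (I : eqType) (j : I) (a : I * bool) : free_ring I :=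
  if a.1 != j then [::] else if a.2 then [:: (-1, [:: a])] else [:: (1, [::])].

Fixpoint fox (I : eqType) (j : I) (w : word I) : free_ring I :=
  if w is a :: w' then fox_letter j a ++ [seq (c.1, a :: c.2) | c <- fox j w']
  else [::].

Section Laurent.
Variables (C : fieldType) (mu : nat).

(* The field of rational functions C(t_1, ..., t_mu), which contains the
   Laurent polynomial ring. *)
Definition ratfun := {fraction (mpoly mu C)}.
HB.instance Definition _ := GRing.Field.on ratfun.

Definition ratfun_const (c : C) : ratfun := tofrac (mpolyC mu c).
Definition tvar (k : 'I_mu) : ratfun := tofrac (mpolyX C (mnm1 k)).
Definition tmonomial (v : 'rV[int]_mu) : ratfun := \prod_k tvar k ^ v 0 k.

(* The class of f modulo multiplication by t_1^{2k_1} ... t_mu^{2k_mu}. *)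
Definition up_to_even_monomials (f : ratfun) : set ratfun :=
  [set g | exists v : 'rV[int]_mu, g = tmonomial (v *+ 2) * f].
End Laurent.

Section Wada.
(* Generators x_0, ..., x_l; relators r_0, ..., r_{l-1}. *)
Variables (C : fieldType) (mu l : nat) (rels : 'I_l -> word 'I_l.+1).
Local Notation G := (pres_group rels).
Variables (alpha : G -> Algebra.to_multiplicative 'rV[int]_mu) (rho : G -> SL2 C).

Definition wada_Phi (z : free_ring 'I_l.+1) : 'M[ratfun C mu]_2 :=
  \sum_(c <- z) (c.1%:~R * tmonomial C (alpha (wclass rels c.2)))
                  *: map_mx (@ratfun_const C mu) (rho (wclass rels c.2)).

Definition wada_num (j : 'I_l.+1) : ratfun C mu :=
  \det (\mxblock_(i < l, k < l) wada_Phi (fox (lift j k) (rels i))).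

Definition wada_den (j : 'I_l.+1) : ratfun C mu :=
  \det (wada_Phi [:: (1, [:: (j, false)]); (-1, [::])]).

Definition twisted_alexander : set (ratfun C mu) :=
  [set f | exists2 j, wada_den j != 0 &
           up_to_even_monomials (wada_num j / wada_den j) f].
End Wada.

Section TorusLink.
Variables mu p q : nat.

(* For mu >= 1 the generators are, in this order, m_1, ..., m_{mu-1}, x, y;
   the last meridian m_mu = x^r y^s (m_{mu-1} ... m_1)^{-1}, with
   p s + q r = 1, has been eliminated. *)
Definition gen_x : 'I_mu.+1 := inord mu.-1.
Definition gen_y : 'I_mu.+1 := ord_max.

(* [x^p, m_i] for the first mu - 1 indices, and x^p y^{-q} for the last. *)
Definition link_rels (i : 'I_mu) : word 'I_mu.+1 :=
  let xp := pow_word gen_x p in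
  if (i < mu.-1)%N then
    let m := pow_word (inord i : 'I_mu.+1) 1 in
    xp ++ m ++ inv_word xp ++ inv_word m
  else xp ++ inv_word (pow_word gen_y q).

Definition link_group := pres_group link_rels.
HB.instance Definition _ := Group.on link_group.

Definition link_x : link_group := gen link_rels gen_x.
Definition link_y : link_group := gen link_rels gen_y.

(* H_1 is Z^mu, the row vector v standing for t_1^{v_1} ... t_mu^{v_mu}. *)
Definition link_ab_gen (i : 'I_mu.+1) : Algebra.to_multiplicative 'rV[int]_mu :=
  \row_k (if (i < mu.-1)%N then (val k == val i)%:Z
          else if i == gen_x then q%:Z else p%:Z).

Definition link_ab (g : link_group) : Algebra.to_multiplicative 'rV[int]_mu :=
  pres_lift link_ab_gen g.
End TorusLink.

Section TorusLinkAbelianization.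
Variables mu p q : nat.
Hypothesis mu_gt0 : (0 < mu)%N.
Local Notation ab_gen := (link_ab_gen (mu := mu) p q).
Local Notation ab := (@link_ab mu p q).

Lemma link_ab_gen_m (i : 'I_mu.+1) : (i < mu.-1)%N ->
  ab_gen i = \row_k (val k == val i)%:Z.
Proof. by move=> hi; apply/rowP => k; rewrite !mxE hi. Qed.

Lemma val_gen_x : gen_x mu = mu.-1 :> nat.
Proof. by rewrite /= inordK // ltnS leq_pred. Qed.

Lemma link_ab_gen_x : ab_gen (gen_x mu) = const_mx q%:Z.
Proof. by apply/rowP => k; rewrite !mxE val_gen_x ltnn eqxx. Qed.

Lemma link_ab_gen_y : ab_gen (gen_y mu) = const_mx p%:Z.
Proof.
apply/rowP => k; rewrite !mxE /= ltnNge leq_pred /=.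
by rewrite -(inj_eq val_inj) /= val_gen_x gtn_eqF // ltn_predL.
Qed.

Lemma link_ab_rels i : eval_word ab_gen (@link_rels mu p q i) = 1%g.
Proof.
rewrite /link_rels; case: ifP => _; rewrite !eval_word_cat !eval_word_inv.
  rewrite !eval_word_pow; set u := (_ ^+ p)%g; set v := (_ ^+ 1)%g.
  have -> : (u * (v * (u^-1 * v^-1)))%g = (u + (v + (- u + - v)) : 'rV[int]_mu).
    by [].
  by rewrite [v + _]addrC -addrA addNr addr0 addrN.
rewrite !eval_word_pow link_ab_gen_x link_ab_gen_y.
have E (v : 'rV[int]_mu) n :
    ((v : Algebra.to_multiplicative 'rV[int]_mu) ^+ n)%g = v *+ n.
  by elim: n => [|n ih] //; rewrite expgS ih mulrS.
rewrite !E; have -> : (const_mx q%:Z *+ p = const_mx p%:Z *+ q :> 'rV[int]_mu).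
  by apply/rowP => k; rewrite !mulmxnE !mxE -[LHS]mulr_natr -[RHS]mulr_natr mulrC !natz.
exact: mulgV.
Qed.

Lemma link_abM : {morph ab : g h / (g * h)%g}.
Proof. exact: pres_liftM link_ab_rels. Qed.

Lemma link_ab_m (i : 'I_mu.+1) : (i < mu.-1)%N ->
  ab (gen (link_rels p q) i) = \row_k (val k == val i)%:Z.
Proof. by move=> hi; rewrite /link_ab (pres_lift_gen link_ab_rels) link_ab_gen_m. Qed.

Lemma link_ab_x : ab (link_x mu p q) = const_mx q%:Z.
Proof. by rewrite /link_ab (pres_lift_gen link_ab_rels) link_ab_gen_x. Qed.

Lemma link_ab_y : ab (link_y mu p q) = const_mx p%:Z.
Proof. by rewrite /link_ab (pres_lift_gen link_ab_rels) link_ab_gen_y. Qed.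
End TorusLinkAbelianization.

Section CharacterVariety.
Variables (C : numClosedFieldType) (mu p q : nat).
Local Notation G := (link_group mu p q).

Definition irreducible_rep (rho : G -> SL2 C) : Prop :=
  forall V : {vspace 'cV[C]_2},
    (forall g v, v \in V -> rho g *m v \in V) -> V = 0%VS \/ V = fullv.

Record irr_rep := IrrRep {
  irr_hom :> {multiplicative G -> SL2 C};
  irr_homP : irreducible_rep irr_hom }.
HB.instance Definition _ := gen_eqMixin irr_rep.
HB.instance Definition _ := gen_choiceMixin irr_rep.

(* Computed from the presentation of deficiency one defining G. *)
Definition link_twisted_alexander (rho : G -> SL2 C) : set (ratfun C mu) :=
  twisted_alexander (@link_ab mu p q) rho.

Definition irr_coords (rho : irr_rep) :
    prod_topology (fun _ : 'I_mu.+1 => 'M[C]_2) :=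
  fun i => rho (gen (link_rels p q) i).

Definition irr_space := initial_topology irr_coords.

Definition conj_rel : rel irr_space := fun rho1 rho2 : irr_rep =>
  `[< exists P : SL2 C, forall g, rho2 g = (P * rho1 g * P^-1)%g >].

Lemma conj_rel_equiv : equiv_class_of conj_rel.
Proof.
split=> [r|r1 r2|r2 r1 r3].
- by apply/asboolP; exists 1%g => g; rewrite mul1g invg1 mulg1.
- by apply/asboolP/asboolP => -[P h]; exists P^-1%g => g;
    rewrite h invgK -!mulgA mulVg mulg1 mulKg.
- move=> /asboolP [P h] /asboolP [Q h']; apply/asboolP; exists (Q * P)%g => g.
  by rewrite h' h invgM !mulgA.
Qed.
Canonical conj_equiv := EquivRelPack conj_rel_equiv.

Definition char_variety := quotient_topology {eq_quot conj_equiv}.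

Definition char_class (rho : irr_rep) : char_variety :=
  \pi_({eq_quot conj_equiv}) (rho : irr_space).
End CharacterVariety.

Section ComplexExponential.
Variable R : realType.
Local Open Scope complex_scope.

Definition cexp (z : R[i]) : R[i] :=
  (expR (complex.Re z))%:C *
  (cos (complex.Im z) +i* sin (complex.Im z)).

Definition exp_ipi (a n : nat) : R[i] := cexp ('i * (pi * a%:R / n%:R)%:C).

Definition diag_inv (c : R[i]) : 'M[R[i]]_2 :=
  diag_mx (\row_k if k == 0 then c else c^-1).
End ComplexExponential.

(* Main.v *)
From HB Require Import structures.
Require Import Defs.
From mathcomp Require Import all_boot all_order all_algebra.
From mathcomp Require Import all_classical all_reals all_analysis.
From mathcomp Require Import perm complex.
From mathcomp Require Import -(notations) mpoly.
From mathcomp Require Import ring.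

Import Order.TTheory GRing.Theory Num.Theory.
Import numFieldNormedType.Exports.

(** Write Phi for the linear extension of g |-> ab(g) rho(g), where ab is the
   abelianization, and X = rho(x), Y = rho(y), t = t_1 ... t_mu.

   The element x^p = y^q is central in the link group, so Schur's lemma makes
   X^p = Y^q a scalar e with e^2 = 1; when X has eigenvalues alpha^+-1 with
   alpha = exp(i pi a / p), this scalar is visibly alpha^p = (-1)^a. Hence
   Phi(x^p) is the scalar t^(pq) e, and the Fox matrix of the presentation is
   almost diagonal: the commutator [x^p, m_i] has derivative
   kappa = t^(pq) e - 1 (times the identity) with respect to m_i and 0 with
   respect to the other meridians, while x^p y^-q has derivative
   S = 1 + Phi(x) + ... + Phi(x)^(p-1) with respect to x and involves no
   meridian. Deleting the column of y leaves a block triangular matrix of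
   determinant kappa^(2 (mu - 1)) det S (lemma [link_wada_num]). As
   S (Phi(x) - 1) = Phi(x)^p - 1 = kappa I, one gets
     Delta = kappa^(2 mu) / (det(Phi(x) - 1) det(Phi(y) - 1))
   with kappa^2 = (t^(pq) - e)^2, and the two factors of the denominator are the
   characteristic polynomials of X and Y evaluated at t^q and t^p (lemma
   [link_twisted_alexander_traces]).
   The set of values of the invariant ranges over all columns with a nonzero
   denominator; they all give the same quotient by the fundamental formula
   of the free differential calculus (lemma [wada_num_den]).

   The formula shows that Delta depends only on tr X, tr Y and e. The scalar e
   is determined by tr X, since e is the p-th power of an eigenvalue of X. As
   e^2 = 1, the eigenvalues of X are 2p-th roots of unity and those of Y are
   2q-th roots of unity, so both traces take finitely many values on irreducible
   representations. Being continuous and invariant under conjugation, they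
   are locally constant on the character variety, and so is Delta. *)

Set Implicit Arguments.
Unset Strict Implicit.
Unset Printing Implicit Defensive.

Local Open Scope ring_scope.
Local Open Scope classical_set_scope.

(** * Determinants of matrices of 2x2 blocks *)

Section BlockDet.
Variable K : comPzRingType.

Lemma det_castmx m n (e : m = n) (A : 'M[K]_m) :
  \det (castmx (e, e) A) = \det A.
Proof. by case: n / e. Qed.

(** Reindexing rows and columns by the same bijection squares its signature away. *)
Lemma det_mxsub_inj m n (f : 'I_m -> 'I_n) (A : 'M[K]_n) :
  m = n -> injective f -> \det (mxsub f f A) = \det A.
Proof.
move=> e; case: n / e f A => f A f_inj.
have -> : mxsub f f A = row_perm (perm f_inj) (col_perm (perm f_inj) A).
  by apply/matrixP => i j; rewrite !mxE !permE.
rewrite row_permE col_permE !det_mulmx !det_perm odd_permV mulrC -mulrA.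
by rewrite -signr_addb addbb mulr1.
Qed.

(** Grouping the indices by their position inside the blocks, instead of by block,
   turns block permutations into ordinary permutation matrices. *)
Lemma det_mxblock_kron n (B : 'I_n -> 'I_n -> 'M[K]_2) :
  \det (\mxblock_(i < n, j < n) B i j) =
  \det (block_mx (\matrix_(i, j) B i j 0 0) (\matrix_(i, j) B i j 0 1)
                 (\matrix_(i, j) B i j 1 0) (\matrix_(i, j) B i j 1 1)).
Proof.
pose f (s : 'I_(\sum_(i < n) 2)) : 'I_(n + n) :=
  if tagnat.sig2 s == 0 then lshift n (tagnat.sig1 s)
  else rshift n (tagnat.sig1 s).
have e2 (k : 'I_2) : k != 0 -> k = 1.
  by case: k => [[|[|//]]] // *; apply: val_inj.
have f_inj : injective f.
  move=> s t; rewrite /f.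
  rewrite -[s]tagnat.sigK -[t]tagnat.sigK /tagnat.sig1 /tagnat.sig2 !tagnat.rankK.
  case: (tagnat.sig s) => i k; case: (tagnat.sig t) => j l /=.
  case: eqVneq => [->|/e2 ->]; case: eqVneq => [->|/e2 ->] /eqP;
    by rewrite ?eq_lrshift ?eq_rlshift ?eq_lshift ?eq_rshift // => /eqP ->.
rewrite -[RHS](@det_mxsub_inj _ _ f) //; last first.
  by rewrite sum_nat_const card_ord muln2 addnn.
congr (\det _); apply/matrixP => s t; rewrite !mxE /f.
by case: eqVneq => [->|/e2 ->]; case: eqVneq => [->|/e2 ->];
   rewrite ?(unsplitK (inl _)) ?(unsplitK (inr _)) !mxE
           ?(unsplitK (inl _)) ?(unsplitK (inr _)) !mxE.
Qed.

(** A permutation of blocks of even size is an even permutation of indices. This is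
   why Wada's quotient carries no sign. *)
Lemma det_mxblock_perm n (s t : 'S_n) (B : 'I_n -> 'I_n -> 'M[K]_2) :
  \det (\mxblock_(i < n, j < n) B (s i) (t j)) =
  \det (\mxblock_(i < n, j < n) B i j).
Proof.
have permE2 a b : \matrix_(i < n, j < n) B (s i) (t j) a b =
    perm_mx s *m (\matrix_(i < n, j < n) B i j a b) *m perm_mx t^-1.
  by rewrite -col_permE -row_permE; apply/matrixP => i j; rewrite !mxE.
rewrite !det_mxblock_kron !permE2.
set P := perm_mx s; set Q := perm_mx _.
rewrite (_ : block_mx _ _ _ _ = block_mx P 0 0 P *m
  block_mx (\matrix_(i, j) B i j 0 0) (\matrix_(i, j) B i j 0 1)
           (\matrix_(i, j) B i j 1 0) (\matrix_(i, j) B i j 1 1)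
  *m block_mx Q 0 0 Q); last first.
  by rewrite !mulmx_block !(mul0mx, mulmx0, addr0, add0r).
rewrite !det_mulmx !det_ublock !det_perm -!expr2 !sqrr_sign.
by rewrite mul1r mulr1.
Qed.

(** Laplace expansion along a block row with at most one nonzero block. *)
Lemma det_mxblock_row n (B : 'I_n.+1 -> 'I_n.+1 -> 'M[K]_2) i0 j0 :
  (forall j, B i0 (lift j0 j) = 0) ->
  \det (\mxblock_(i < n.+1, j < n.+1) B i j) =
  \det (B i0 j0) * \det (\mxblock_(i < n, j < n) B (lift i0 i) (lift j0 j)).
Proof.
move=> B0; rewrite -(det_mxblock_perm (lift_perm 0 i0 1) (lift_perm 0 j0 1)).
rewrite mxblock_recul det_castmx.
rewrite (_ : \mxrow_j _ = 0); last first.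
  rewrite -[RHS]mxrow0; apply: eq_mxrow => j.
  by rewrite lift_perm_id lift_perm_lift perm1.
rewrite det_lblock !lift_perm_id; congr (_ * \det _).
by apply: eq_mxblock => i j; rewrite !lift_perm_lift !perm1.
Qed.

Lemma det_mxblock_col n (B : 'I_n.+1 -> 'I_n.+1 -> 'M[K]_2) i0 j0 :
  (forall i, B (lift i0 i) j0 = 0) ->
  \det (\mxblock_(i < n.+1, j < n.+1) B i j) =
  \det (B i0 j0) * \det (\mxblock_(i < n, j < n) B (lift i0 i) (lift j0 j)).
Proof.
move=> B0; rewrite -det_tr tr_mxblock.
rewrite (@det_mxblock_row _ (fun i j => (B j i)^T) j0 i0).
  by rewrite det_tr -tr_mxblock det_tr.
by move=> i; rewrite B0 trmx0.
Qed.

Lemma det_mxblock_diag n (B : 'I_n -> 'I_n -> 'M[K]_2) d :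
  (forall i j, i != j -> B i j = 0) -> (forall i, \det (B i i) = d) ->
  \det (\mxblock_(i < n, j < n) B i j) = d ^+ n.
Proof.
elim: n B => [|n IH] B B0 Bd.
  by rewrite det_mxblock_kron expr0 det_mx00.
rewrite (@det_mxblock_row _ _ 0 0) => [|j]; last by rewrite B0 // neq_lift.
rewrite Bd exprS IH // => i j ij.
by rewrite B0 // (inj_eq lift_inj).
Qed.
End BlockDet.

Lemma det_mx22 (K : comNzRingType) (M : 'M[K]_2) :
  \det M = M 0 0 * M 1 1 - M 0 1 * M 1 0.
Proof.
rewrite (expand_det_row _ 0) big_ord_recl big_ord1 /cofactor !det_mx11 !mxE /=.
rewrite expr0 expr1 mul1r mulN1r mulrN.
by congr (_ * M _ _ - M _ _ * M _ _); apply: val_inj.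
Qed.

Lemma mxtrace22 (K : comNzRingType) (M : 'M[K]_2) : \tr M = M 0 0 + M 1 1.
Proof.
by rewrite /mxtrace big_ord_recl big_ord1; congr (_ + M _ _); apply: val_inj.
Qed.

(** * Twisted Fox calculus and Wada's quotient *)

HB.instance Definition _ (C : fieldType) (mu : nat) :=
  GRing.RMorphism.copy (@ratfun_const C mu)
    (@tofrac (mpoly mu C) \o @mpolyC mu C).

Section Monomials.
Variables (C : fieldType) (mu : nat).

Lemma tvar_neq0 (k : 'I_mu) : tvar C k != 0.
Proof. by rewrite tofrac_eq0 -msize_poly_eq0 msizeX. Qed.

Lemma tmonomial0 : tmonomial C (0 : 'rV[int]_mu) = 1.
Proof. by rewrite /tmonomial big1 // => k _; rewrite mxE expr0z. Qed.

Lemma tmonomialD (u v : 'rV[int]_mu) :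
  tmonomial C (u + v) = tmonomial C u * tmonomial C v.
Proof.
rewrite /tmonomial -big_split; apply: eq_bigr => k _.
by rewrite mxE expfzDr // tvar_neq0.
Qed.

Lemma tmonomial_const n :
  tmonomial C (const_mx n%:Z : 'rV[int]_mu) = (\prod_k tvar C k) ^+ n.
Proof. by rewrite /tmonomial -prodrXl; apply: eq_bigr => k _; rewrite mxE. Qed.
End Monomials.

Lemma morph_eq1 (G H : groupType) (f : G -> H) :
  {morph f : g h / (g * h)%g} -> f 1%g = 1%g.
Proof. by move=> fM; apply: (mulgI (f 1%g)); rewrite -fM !mulg1. Qed.

Lemma morph_expg (G H : groupType) (f : G -> H) :
  {morph f : g h / (g * h)%g} -> forall n, {morph f : g / (g ^+ n)%g}.
Proof.
move=> fM; elim=> [|n IH] g; first by rewrite !expg0 (morph_eq1 fM).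
by rewrite !expgS fM IH.
Qed.

Lemma divf_cross (F : fieldType) (a b c d : F) :
  b != 0 -> d != 0 -> a * d = c * b -> a / b = c / d.
Proof. by move=> b0 d0 /eqP; rewrite -eqr_div // => /eqP. Qed.

Section WadaInvariant.
Variables (C : fieldType) (mu l : nat) (rels : 'I_l -> word 'I_l.+1).
Local Notation G := (pres_group rels).
Variables (alpha : G -> Algebra.to_multiplicative 'rV[int]_mu) (rho : G -> SL2 C).
Hypothesis alphaM : {morph alpha : g h / (g * h)%g}.
Hypothesis rhoM : {morph rho : g h / (g * h)%g}.

(** The tensor product of alpha and rho, whose linear extension to the group ring
   evaluates Fox derivatives. *)
Definition twist (g : G) : 'M[ratfun C mu]_2 :=
  tmonomial C (alpha g) *: map_mx (@ratfun_const C mu) (rho g).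

Local Notation Phi := (wada_Phi alpha rho).
Local Notation cls := (wclass rels).

Lemma twistM g h : twist (g * h)%g = twist g *m twist h.
Proof.
rewrite /twist alphaM rhoM map_mxM tmonomialD.
by rewrite -scalemxAl -scalemxAr scalerA.
Qed.

Lemma twist1 : twist 1%g = 1%:M.
Proof.
rewrite /twist (morph_eq1 alphaM) (morph_eq1 rhoM) map_mx1.
by rewrite tmonomial0 scale1r.
Qed.

Lemma wclass_cat v w : cls (v ++ w) = (cls v * cls w)%g.
Proof. by rewrite [RHS]pres_mulE. Qed.

Lemma wclass_inv w : cls (inv_word w) = (cls w)^-1%g.
Proof. by rewrite [RHS]pres_invE. Qed.

Lemma wclass_rel i : cls (rels i) = 1%g.
Proof.
rewrite -[RHS]/(cls [::]); apply/wclassP.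
by have := Pres_rel rels [::] i [::]; rewrite cats0.
Qed.

Lemma wclass_pow i n : cls (pow_word i n) = (gen rels i ^+ n)%g.
Proof.
elim: n => [|n IH]; first by rewrite expg0.
by rewrite expgS -IH -wclass_cat.
Qed.

Lemma twistV g : twist g^-1%g *m twist g = 1%:M.
Proof. by rewrite -twistM mulVg twist1. Qed.

Lemma twist_pow i n : twist (cls (pow_word i n)) = twist (gen rels i) ^+ n.
Proof.
elim: n => [|n IH]; first by rewrite expr0 twist1.
by rewrite exprS -IH -[_ * _]twistM -wclass_cat.
Qed.

Lemma wada_PhiE z :
  Phi z = \sum_(c <- z) c.1%:~R *: twist (cls c.2).
Proof. by apply: eq_bigr => c _; rewrite scalerA. Qed.

Lemma wada_Phi_cat z1 z2 : Phi (z1 ++ z2) = Phi z1 + Phi z2.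
Proof. by rewrite /wada_Phi big_cat. Qed.

Lemma wada_Phi_nil : Phi [::] = 0.
Proof. by rewrite /wada_Phi big_nil. Qed.

Lemma wada_Phi_mul v z :
  Phi [seq (c.1, v ++ c.2) | c <- z] = twist (cls v) *m Phi z.
Proof.
rewrite !wada_PhiE big_map mulmx_sumr; apply: eq_bigr => c _ /=.
by rewrite wclass_cat twistM scalemxAr.
Qed.

(** The product rule of free differentials. *)
Lemma Phi_fox_cat j v w :
  Phi (fox j (v ++ w)) = Phi (fox j v) + twist (cls v) *m Phi (fox j w).
Proof.
elim: v => [|a v IH] /=; first by rewrite wada_Phi_nil add0r twist1 mul1mx.
rewrite !wada_Phi_cat !(wada_Phi_mul [:: a]) IH mulmxDr -addrA mulmxA -twistM.
by rewrite -wclass_cat.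
Qed.

Lemma Phi_fox_inv j w :
  Phi (fox j (inv_word w)) = - (twist (cls w)^-1%g *m Phi (fox j w)).
Proof.
elim: w => [|a w IH]; first by rewrite /= wada_Phi_nil mulmx0 oppr0.
have letter b : Phi (fox j (inv_word [:: b])) =
    - (twist (cls [:: b])^-1%g *m Phi (fox j [:: b])).
  case: b => i b; rewrite /= !cats0 /fox_letter /=.
  case: eqP => _; last by rewrite wada_Phi_nil mulmx0 oppr0.
  case: b => /=; rewrite !wada_PhiE !big_seq1 /= ?scale1r ?scaleN1r twist1.
    by rewrite mulmxN twistV opprK.
  by rewrite mulmx1 -wclass_inv.
rewrite -[a :: w]cat1s inv_word_cat !Phi_fox_cat IH letter wclass_inv.
rewrite wclass_cat invgM twistM mulmxDr opprD mulmxN addrC; congr (_ - _).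
  by rewrite -mulmxA.
by rewrite -mulmxA [X in _ = _ *m X]mulmxA twistV mul1mx.
Qed.

(** The fundamental formula of the free differential calculus. *)
Lemma Phi_fox_fundamental w :
  \sum_j Phi (fox j w) *m (twist (gen rels j) - 1%:M) = twist (cls w) - 1%:M.
Proof.
elim: w => [|a w IH] /=.
  by rewrite twist1 subrr big1 // => j _; rewrite wada_Phi_nil mul0mx.
under eq_bigr do rewrite wada_Phi_cat (wada_Phi_mul [:: a]) mulmxDl -mulmxA.
rewrite big_split /= -mulmx_sumr IH mulmxBr mulmx1 -twistM -wclass_cat /=.
rewrite (bigD1 a.1) //= big1 ?addr0 => [|j ja]; last first.
  by rewrite /fox_letter eq_sym ja wada_Phi_nil mul0mx.
rewrite [X in X + _ = _](_ : _ = twist (cls [:: a]) - 1%:M).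
  by rewrite addrC addrA subrK.
case: a => i b; rewrite /fox_letter /= eqxx /= wada_PhiE.
case: b; rewrite big_seq1 /=; last first.
  by rewrite scale1r twist1 mul1mx.
have -> : cls [:: (i, true)] = (gen rels i)^-1%g by rewrite -wclass_inv.
by rewrite scaleN1r mulmxBr !mulNmx twistV mulmx1 opprK addrC.
Qed.

Lemma wada_denE j : wada_den alpha rho j = \det (twist (gen rels j) - 1%:M).
Proof.
by rewrite /wada_den wada_PhiE big_cons big_seq1 /= scale1r scaleN1r twist1.
Qed.

(** A square block matrix B is obtained from the Fox matrix by adding the row with a
   single block 1 in column j, so that det B is the numerator for column j. Let V
   be the identity with column k replaced by the blocks Phi(x_i) - 1, so that
   det V is the denominator for column k. The fundamental formula kills
   column k of B V outside the last row, where it is Phi(x_j) - 1; so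
   det (B V) is the numerator for k times the denominator for j. *)
Lemma wada_num_den j k :
  wada_num alpha rho j * wada_den alpha rho k =
  wada_num alpha rho k * wada_den alpha rho j.
Proof.
pose A i c := Phi (fox c (rels i)).
pose B (i c : 'I_l.+1) :=
  if unlift ord_max i is Some i' then A i' c else if c == j then 1%:M else 0.
pose V (i c : 'I_l.+1) : 'M[ratfun C mu]_2 :=
  if c == k then twist (gen rels i) - 1%:M else if i == c then 1%:M else 0.
pose W (i c : 'I_l.+1) :=
  if unlift ord_max i is Some i' then if c == k then 0 else A i' c
  else V j c.
have detB : \det (\mxblock_(i, c) B i c) = wada_num alpha rho j.
  rewrite (@det_mxblock_row _ _ _ ord_max j) => [|c].
    rewrite {1}/B unlift_none eqxx det1 mul1r; congr (\det _).
    by apply: eq_mxblock => i c; rewrite /B liftK.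
  by rewrite /B unlift_none lift_eqF.
have detV : \det (\mxblock_(i, c) V i c) = wada_den alpha rho k.
  rewrite (@det_mxblock_row _ _ _ k k) => [|c]; last first.
    by rewrite /V lift_eqF eq_liftF.
  rewrite {1}/V eqxx wada_denE -[RHS]mulr1; congr (_ * _).
  rewrite (@det_mxblock_diag _ _ _ 1) ?expr1n // => i.
    by move=> c ic; rewrite /V lift_eqF (inj_eq lift_inj) (negPf ic).
  by rewrite /V lift_eqF eqxx det1.
have detW : \det (\mxblock_(i, c) W i c) =
    wada_den alpha rho j * wada_num alpha rho k.
  rewrite (@det_mxblock_col _ _ _ ord_max k) => [|i]; last first.
    by rewrite /W liftK eqxx.
  rewrite {1}/W unlift_none /V eqxx wada_denE; congr (_ * \det _).
  by apply: eq_mxblock => i c; rewrite /W liftK lift_eqF.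
rewrite -detB -detV -det_mulmx mul_mxblock mulrC -detW; congr (\det _).
apply: eq_mxblock => i c; rewrite /W /B.
case: unliftP => [i'|] _; last first.
  rewrite (bigD1 j) //= eqxx mul1mx big1 ?addr0 // => s /negPf ->.
  by rewrite mul0mx.
rewrite /V; case: eqVneq => [_|ck].
  by rewrite Phi_fox_fundamental wclass_rel twist1 subrr.
rewrite (bigD1 c) //= eqxx mulmx1 big1 ?addr0 // => s /negPf ->.
by rewrite mulmx0.
Qed.

Lemma twisted_alexanderE j : wada_den alpha rho j != 0 ->
  twisted_alexander alpha rho =
  up_to_even_monomials (wada_num alpha rho j / wada_den alpha rho j).
Proof.
move=> dj; apply/seteqP; split=> f; last by exists j.
by case=> k dk; rewrite (divf_cross dk dj (wada_num_den k j)).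
Qed.
End WadaInvariant.

(** * The invariant of a torus link in terms of traces *)

(** For M in SL2 with trace tr, this is det (s M - 1), which is also the
   characteristic polynomial of M at s. *)
Definition sl2_charpoly (K : pzRingType) (tr s : K) : K := s ^+ 2 - tr * s + 1.

Lemma det_scale_sub1 (K : comNzRingType) (M : 'M[K]_2) (s : K) :
  \det M = 1 -> \det (s *: M - 1%:M) = sl2_charpoly (\tr M) s.
Proof.
rewrite /sl2_charpoly !det_mx22 mxtrace22 !mxE /= mulr1n mulr0n => dM.
rewrite -[s ^+ 2]mulr1 -[X in s ^+ 2 * X]dM; ring.
Qed.

Section Transcendence.
Variables (C : fieldType) (mu : nat).
Hypothesis mu_gt0 : (0 < mu)%N.
Local Notation t := (\prod_(k < mu) tvar C k).
Local Notation c := (@ratfun_const C mu).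

(** The fraction is a polynomial in t_1, ..., t_mu with constant term 1. *)
Lemma sl2_charpoly_neq0 a n : (0 < n)%N -> sl2_charpoly (c a) (t ^+ n) != 0.
Proof.
move=> n0; pose T : mpoly mu C := \prod_(k < mu) mpolyX C (mnm1 k).
have -> : sl2_charpoly (c a) (t ^+ n) =
    tofrac ((T ^+ n) ^+ 2 - mpolyC mu a * T ^+ n + 1).
  rewrite rmorphD rmorphB rmorphXn (rmorphM _ (mpolyC mu a)) !rmorphXn.
  by rewrite rmorph1 rmorph_prod.
rewrite tofrac_eq0; apply/eqP => /(congr1 (meval (fun=> 0))).
have T0 : meval (fun=> 0) T = 0.
  by rewrite rmorph_prod (bigD1 (Ordinal mu_gt0)) //= mevalXU mul0r.
have Tn0 : meval (fun=> 0) (T ^+ n) = 0 :> C.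
  by rewrite rmorphXn /= T0 expr0n gtn_eqF.
rewrite rmorphD rmorphB rmorphXn (rmorphM _ (mpolyC mu a)) rmorph1 /= Tn0.
by rewrite expr0n mulr0 subr0 add0r meval0 => /eqP; rewrite oner_eq0.
Qed.
End Transcendence.

Lemma divf_mul_denom (F : fieldType) (a b d k : F) :
  b != 0 -> a * b = k -> a / d = k / (d * b).
Proof. by move=> b0 <-; rewrite invfM mulrACA divff // mulr1. Qed.

Section LinkInvariant.
Variables (C : fieldType) (m p q : nat).
Local Notation mu := m.+1.
Hypotheses (p_gt0 : (0 < p)%N) (q_gt0 : (0 < q)%N).
Variable rho : link_group mu p q -> SL2 C.
Hypothesis rhoM : {morph rho : g h / (g * h)%g}.
Local Notation t := (\prod_(k < mu) tvar C k).
Local Notation c := (@ratfun_const C mu).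
Local Notation al := (@link_ab mu p q).
Local Notation alM := (@link_abM mu p q (ltn0Sn m)).
Local Notation tw := (twist al rho).
Local Notation Phi := (wada_Phi al rho).
Local Notation rels := (@link_rels mu p q).

Lemma Phi_fox_pow j i n :
  Phi (fox j (pow_word i n)) =
  if i == j then \sum_(k < n) tw (gen rels i) ^+ k else 0.
Proof.
elim: n => [|n IH]; first by rewrite /= wada_Phi_nil big_ord0; case: ifP.
have -> : pow_word i n.+1 = [:: (i, false)] ++ pow_word i n by [].
rewrite (Phi_fox_cat alM rhoM) IH /= /fox_letter /= cats0.
case: eqP => _; last by rewrite wada_Phi_nil mulmx0 addr0.
rewrite wada_PhiE big_seq1 /= scale1r (twist1 alM rhoM) big_ord_recl expr0.
by congr (_ + _); rewrite mulmx_sumr; apply: eq_bigr => k _; rewrite exprS.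
Qed.

Lemma twist_x : tw (link_x mu p q) = t ^+ q *: map_mx c (rho (link_x mu p q)).
Proof. by rewrite /twist link_ab_x // tmonomial_const. Qed.

Lemma twist_y : tw (link_y mu p q) = t ^+ p *: map_mx c (rho (link_y mu p q)).
Proof. by rewrite /twist link_ab_y // tmonomial_const. Qed.

Lemma det_twist_sub1 (g : link_group mu p q) s :
  tw g = s *: map_mx c (rho g) ->
  \det (tw g - 1%:M) = sl2_charpoly (c (\tr (rho g))) s.
Proof.
move=> ->; rewrite det_scale_sub1; last by rewrite det_map_mx sl2_det rmorph1.
by rewrite trace_map_mx.
Qed.

Variable e : C.
Hypothesis e2 : e ^+ 2 = 1.
Hypothesis Xp : sl2_mx (rho (link_x mu p q)) ^+ p = e%:M.
Local Notation kappa := (t ^+ (p * q) * c e - 1).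

Lemma twist_xp : tw (link_x mu p q) ^+ p = (t ^+ (p * q) * c e)%:M.
Proof.
have XpC : map_mx c (rho (link_x mu p q)) ^+ p = (c e)%:M.
  by rewrite -map_scalar_mx -Xp rmorphXn.
by rewrite twist_x exprZn XpC scale_scalar_mx -exprM mulnC.
Qed.

(** (1 + z + ... + z^(p-1)) (z - 1) = z^p - 1 for z = Phi(x), and Phi(x)^p is the
   scalar kappa + 1. *)
Lemma det_x_geometric :
  \det (\sum_(k < p) tw (link_x mu p q) ^+ k) * \det (tw (link_x mu p q) - 1%:M)
  = kappa ^+ 2.
Proof.
rewrite mulrC -det_mulmx.
have -> (M : 'M[ratfun C mu]_2) : (M - 1%:M) *m (\sum_(k < p) M ^+ k) =
    M ^+ p - 1%:M by rewrite [RHS]subrX1.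
by rewrite twist_xp -raddfB det_scalar.
Qed.

Lemma gen_x_lift : gen_x mu = lift ord_max ord_max.
Proof. by apply: ord_inj; rewrite val_gen_x lift_max. Qed.

Lemma Phi_fox_last (j : 'I_mu.+1) : j != gen_y mu ->
  Phi (fox j (rels ord_max)) =
  if gen_x mu == j then \sum_(k < p) tw (link_x mu p q) ^+ k else 0.
Proof.
move=> jy; rewrite /link_rels /= ltnn (Phi_fox_cat alM rhoM) (Phi_fox_inv alM rhoM).
by rewrite !Phi_fox_pow [gen_y mu == j]eq_sym (negPf jy) mulmx0 oppr0 mulmx0 addr0.
Qed.

(** The derivative of [x^p, m] with respect to m is x^p - [x^p, m], and the
   commutator is trivial in the group. *)
Lemma Phi_fox_commutator (i k : 'I_m) :
  Phi (fox (lift ord_max (lift ord_max k)) (rels (lift ord_max i))) =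
  if i == k then kappa%:M else 0.
Proof.
have lm n (h : 'I_n) : lift ord_max h = h :> nat by rewrite lift_max.
have hi : (lift ord_max i < mu.-1)%N by rewrite lm.
pose M := pow_word (inord i : 'I_mu.+1) 1; pose X := pow_word (gen_x mu) p.
have relE : rels (lift ord_max i) = X ++ M ++ inv_word X ++ inv_word M.
  by rewrite /link_rels hi lm.
have := wclass_rel rels (lift ord_max i); rewrite relE => r1.
have xk : (gen_x mu == lift ord_max (lift ord_max k)) = false.
  by rewrite gen_x_lift (inj_eq lift_inj) eq_liftF.
have ik : (inord i == lift ord_max (lift ord_max k)) = (i == k).
  rewrite -[LHS](inj_eq (@ord_inj _)) -[RHS](inj_eq (@ord_inj _)).
  by rewrite !lm inordK // (leqW (leqW (ltn_ord i))).
rewrite !(Phi_fox_cat alM rhoM) !(Phi_fox_inv alM rhoM).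
rewrite !Phi_fox_pow xk ik mulmx0 oppr0 !add0r.
case: eqP => _; last by rewrite !(mulmx0, oppr0, addr0).
rewrite big_ord1 expr0; set I1 := 1; have -> : I1 = 1%:M by [].
rewrite !mulmxN !mulmx1 mulmxDr mulmx1 !mulmxN.
rewrite !wclass_cat !wclass_inv in r1.
rewrite (wclass_inv _ X) -!(twistM alM rhoM) r1 (twist1 alM rhoM).
by rewrite (twist_pow alM rhoM) twist_xp raddfB.
Qed.

(** With the column of y deleted, the last block row is (0, ..., 0, S) where
   S = 1 + Phi(x) + ... + Phi(x)^(p-1), and the other rows have kappa on the
   diagonal and 0 elsewhere in the meridian columns. *)
Lemma link_wada_num :
  wada_num al rho (gen_y mu) * \det (tw (link_x mu p q) - 1%:M) =
  kappa ^+ (2 * mu).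
Proof.
have lastE k : Phi (fox (lift (gen_y mu) k) (rels ord_max)) =
    if ord_max == k then \sum_(k < p) tw (link_x mu p q) ^+ k else 0.
  by rewrite Phi_fox_last ?lift_eqF // gen_x_lift (inj_eq lift_inj).
rewrite /wada_num (@det_mxblock_row _ _ _ ord_max ord_max) => [|k]; last first.
  by rewrite lastE eq_liftF.
rewrite lastE eqxx (@det_mxblock_diag _ _ _ (kappa ^+ 2)).
- by rewrite mulrAC det_x_geometric -exprM -exprD mulnS.
- by move=> i j ij; rewrite Phi_fox_commutator (negPf ij).
- by move=> i; rewrite Phi_fox_commutator eqxx det_scalar.
Qed.

Lemma link_twisted_alexander_traces :
  twisted_alexander al rho =
  up_to_even_monomials
    ((t ^+ (p * q) - c e) ^+ (2 * mu) /
     (sl2_charpoly (c (\tr (rho (link_y mu p q)))) (t ^+ p) *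
      sl2_charpoly (c (\tr (rho (link_x mu p q)))) (t ^+ q))).
Proof.
have dx := det_twist_sub1 twist_x; have dy := det_twist_sub1 twist_y.
have x0 := sl2_charpoly_neq0 (ltn0Sn m) (\tr (rho (link_x mu p q))) q_gt0.
have y0 := sl2_charpoly_neq0 (ltn0Sn m) (\tr (rho (link_y mu p q))) p_gt0.
have dyE : wada_den al rho (gen_y mu) = _ := etrans (wada_denE alM rhoM _) dy.
rewrite (@twisted_alexanderE _ _ _ _ _ _ alM rhoM (gen_y mu)) dyE //.
have := link_wada_num; rewrite dx => num.
have ke : kappa ^+ (2 * mu) = (t ^+ (p * q) - c e) ^+ (2 * mu).
  rewrite [LHS]exprM [RHS]exprM; congr (_ ^+ mu).
  (* kappa = e (t^(pq) - e), because e^2 = 1 *)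
  have ce2 : c e ^+ 2 = 1 by rewrite -rmorphXn e2 rmorph1.
  have -> : kappa = c e * (t ^+ (p * q) - c e).
    by rewrite mulrBr -expr2 ce2 mulrC.
  by rewrite exprMn ce2 mul1r.
by rewrite (divf_mul_denom _ x0 (etrans num ke)).
Qed.
End LinkInvariant.

(** * Rigidity of traces *)

Section TraceRigidity.
Variable C : closedFieldType.

Lemma sl2_charpoly_root (a : C) : exists s, sl2_charpoly a s = 0.
Proof.
have [s hs] := @solve_monicpoly C 2 (fun i => if i == 0%N then -1 else a) isT.
exists s; rewrite /sl2_charpoly hs !big_ord_recl big_ord0 /= expr0 expr1.
by ring.
Qed.

(** s^-1 is an eigenvalue of X, hence s^-n is an eigenvalue of X^n. In particular the
   scalar X^n is determined by the trace of X. *)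
Lemma sl2_root_power (X : SL2 C) n e s :
  sl2_mx X ^+ n = e%:M -> sl2_charpoly (\tr X) s = 0 -> s ^+ n * e = 1.
Proof.
move=> Xn; rewrite -(det_scale_sub1 _ (sl2_det X)) => /eqP/det0P[v v0].
rewrite mulmxBr mulmx1 -scalemxAr => /eqP; rewrite subr_eq0 => /eqP sv.
have svk k : s ^+ k *: (v *m sl2_mx X ^+ k) = v.
  elim: k => [|k IH]; first by rewrite !expr0 mulmx1 scale1r.
  rewrite exprSr exprSr -[_ * sl2_mx X]/(_ *m sl2_mx X) mulmxA.
  by rewrite mulrC -scalerA scalemxAl IH.
have := svk n; rewrite Xn mul_mx_scalar scalerA => h.
apply/eqP; rewrite -subr_eq0; have := v0; apply: contraNT => /negPf h0.
by have /eqP := scalerBl (s ^+ n * e) 1 v; rewrite h scale1r subrr scaler_eq0 h0.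
Qed.

(** Traces of the elements of SL2 whose eigenvalues are 2n-th roots of unity. *)
Definition finite_order_traces n : set C :=
  [set a | exists2 s, s ^+ (n * 2) = 1 & a = s + s^-1].

Lemma finite_order_traces_finite n : (0 < n)%N -> finite_set (finite_order_traces n).
Proof.
move=> n0; have [r hr] := closed_field_poly_normal ('X^(n * 2) - 1 : {poly C}).
apply: (@sub_finite_set _ _ [set s + s^-1 | s in [set` r]]); last first.
  exact/finite_image/finite_seq.
move=> a [s hs ->]; exists s => //=.
have: root ('X^(n * 2) - 1) s by rewrite rootE !hornerE hs subrr.
rewrite hr rootZ ?root_prod_XsubC //.
by rewrite lead_coefXnsubC ?oner_eq0 // muln_gt0 n0.
Qed.

Lemma sl2_trace_finite (X : SL2 C) n e :
  sl2_mx X ^+ n = e%:M -> e ^+ 2 = 1 -> finite_order_traces n (\tr X).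
Proof.
move=> Xn e2; have [s hs] := sl2_charpoly_root (\tr X).
have sn := sl2_root_power Xn hs; exists s.
  by rewrite exprM -[LHS]mulr1 -e2 -exprMn sn expr1n.
have s0 : s != 0.
  apply: contraPneq hs => ->; rewrite /sl2_charpoly expr0n mulr0 subrr add0r.
  by move/eqP; rewrite oner_eq0.
apply: (mulIf s0); rewrite mulrDl mulVf // -expr2.
by move/eqP: hs; rewrite /sl2_charpoly addrAC subr_eq0 => /eqP.
Qed.
End TraceRigidity.

(** * The central element x^p and Schur's lemma *)

Section CentralPower.
Variables m p q : nat.
Local Notation mu := m.+1.
Local Notation G := (link_group mu p q).
Local Notation rels := (@link_rels mu p q).

Lemma link_xp_yq : (link_x mu p q ^+ p = link_y mu p q ^+ q)%g.
Proof.
have relE : rels ord_max =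
    pow_word (gen_x mu) p ++ inv_word (pow_word (gen_y mu) q).
  by rewrite /link_rels ltnn.
have := wclass_rel rels ord_max.
rewrite relE wclass_cat wclass_inv !wclass_pow.
by move=> /(canRL (mulgK _)); rewrite invgK mul1g.
Qed.

Lemma link_xp_commute_m (k : 'I_m) :
  commute (link_x mu p q ^+ p)%g (gen rels (inord k)).
Proof.
have lm : lift ord_max k = k :> nat by rewrite lift_max.
have hk : (lift ord_max k < mu.-1)%N by rewrite lm.
have relE : rels (lift ord_max k) =
    pow_word (gen_x mu) p ++ pow_word (inord k) 1 ++
    inv_word (pow_word (gen_x mu) p) ++ inv_word (pow_word (inord k) 1).
  by rewrite /link_rels hk lm.
have := wclass_rel rels (lift ord_max k).
rewrite relE !wclass_cat !wclass_inv !wclass_pow expg1 -invgM mulgA.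
by move=> /(canRL (mulgK _)); rewrite invgK mul1g.
Qed.

(** x^p commutes with the meridians by the relations, with x trivially, and with y
   because it equals y^q. *)
Lemma link_xp_central g : commute (link_x mu p q ^+ p)%g g.
Proof.
set z := (_ ^+ p)%g.
have zgen i : commute z (gen rels i).
  case: (ltngtP i m) => hi.
  - have -> : i = inord (Ordinal hi) by apply: ord_inj; rewrite inordK /=.
    exact: link_xp_commute_m.
  - have -> : i = gen_y mu.
      by apply: ord_inj; apply: anti_leq; rewrite leq_ord; exact: hi.
    by rewrite /z link_xp_yq; apply/commute_sym/commuteX.
  - have -> : i = gen_x mu by apply: ord_inj; rewrite val_gen_x.
    by apply/commute_sym/commuteX.
rewrite -(wclass_repr g); elim: (repr g) => [|[i b] w IH].
  exact: commute1.
rewrite -[_ :: w]cat1s wclass_cat; apply: commuteM => //.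
case: b; last exact: zgen.
by rewrite [wclass _ _](wclass_inv rels [:: (i, false)]); exact/commuteV/zgen.
Qed.
End CentralPower.

Section Schur.
Variables (C : numClosedFieldType) (mu p q : nat).
Local Notation G := (link_group mu p q).

(** An eigenspace of A is stable under rho, and nonzero, so it is the whole plane. *)
Lemma schur (rho : G -> SL2 C) (A : 'M[C]_2) : irreducible_rep rho ->
  (forall g, A *m rho g = rho g *m A) -> exists e, A = e%:M.
Proof.
move=> irr Ac.
have [e he] : exists e, root (char_poly A^T) e.
  by apply/closed_rootP; rewrite size_char_poly.
have {he} [v /eqP vA v0] : exists2 v : 'rV_2, v *m A^T == e *: v & v != 0.
  by move: he; rewrite -eigenvalue_root_char => /eigenvalueP[v /eqP]; exists v.
exists e.
pose V := lker (linfun (mulmx (A - e%:M) : 'cV[C]_2 -> 'cV[C]_2)).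
have memV u : (u \in V) = (A *m u == e *: u).
  by rewrite memv_ker lfunE /= mulmxBl mul_scalar_mx subr_eq0.
have [V0|V1] : V = 0%VS \/ V = fullv.
- apply: irr => g u; rewrite !memV => /eqP Au.
  by rewrite mulmxA Ac -mulmxA Au -scalemxAr.
- have : v^T \in V.
    by rewrite memV -[A]trmxK -trmx_mul vA linearZ.
  by rewrite V0 memv0 -(inj_eq trmx_inj) trmxK trmx0 (negPf v0).
apply/eqP; rewrite -subr_eq0; apply/eqP/matrixP => i j.
have : delta_mx j 0 \in V by rewrite V1 memvf.
rewrite memv_ker lfunE /= => /eqP/matrixP/(_ i 0).
by rewrite -colE !mxE.
Qed.
End Schur.

Lemma sl2_mxX (C : fieldType) (A : SL2 C) n : sl2_mx (A ^+ n)%g = sl2_mx A ^+ n.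
Proof. by elim: n => [|n IH]; rewrite ?expr0 ?expg0 // expgS exprS -IH. Qed.

Lemma irreducible_central_power (C : numClosedFieldType) (m p q : nat)
    (rho : {multiplicative link_group m.+1 p q -> SL2 C}) :
  irreducible_rep rho ->
  exists2 e : C, e ^+ 2 = 1 &
    sl2_mx (rho (link_x m.+1 p q)) ^+ p = e%:M /\
    sl2_mx (rho (link_y m.+1 p q)) ^+ q = e%:M.
Proof.
move=> irr; set x := link_x _ _ _; set y := link_y _ _ _.
have [e he] : exists e, sl2_mx (rho (x ^+ p)%g) = e%:M.
  apply: schur irr _ => g; have := link_xp_central g.
  by move=> /(congr1 (fun h => sl2_mx (rho h))); rewrite !gmulfM.
exists e; first by rewrite -det_scalar -he sl2_det.
by rewrite -!sl2_mxX -!(morph_expg (@gmulfM _ _ rho)) -link_xp_yq.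
Qed.

(** * Local constancy on the character variety *)

Section LocalConstancy.
Variables (C : numClosedFieldType) (m p q : nat).
Hypotheses (p_gt0 : (0 < p)%N) (q_gt0 : (0 < q)%N).
Local Notation mu := m.+1.
Local Notation irr := (irr_rep C mu p q).
Local Notation X r := (sl2_mx (irr_hom r (link_x mu p q))).
Local Notation Y r := (sl2_mx (irr_hom r (link_y mu p q))).

Lemma twisted_alexander_of_traces (r1 r2 : irr) :
  \tr (X r1) = \tr (X r2) -> \tr (Y r1) = \tr (Y r2) ->
  link_twisted_alexander r1 = link_twisted_alexander r2.
Proof.
move=> trX trY.
have [e1 e1_2 [X1 _]] := irreducible_central_power (irr_homP (i := r1)).
have [e2 e2_2 [X2 _]] := irreducible_central_power (irr_homP (i := r2)).
have e12 : e1 = e2.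
  have [s hs] := sl2_charpoly_root (\tr (X r1)).
  have h1 := sl2_root_power X1 hs.
  move: hs; rewrite trX => hs; have h2 := sl2_root_power X2 hs.
  have s0 : s ^+ p != 0.
    by apply: contra_eqN h1 => /eqP ->; rewrite mul0r eq_sym oner_eq0.
  by apply: (mulfI s0); rewrite h1 h2.
rewrite /link_twisted_alexander.
rewrite (link_twisted_alexander_traces p_gt0 q_gt0 (@gmulfM _ _ r1) e1_2 X1).
rewrite (link_twisted_alexander_traces p_gt0 q_gt0 (@gmulfM _ _ r2) e2_2 X2).
by rewrite trX trY e12.
Qed.

Lemma mxtrace_continuous : continuous (fun M : 'M[C]_2 => \tr M : C^o).
Proof.
move=> M; rewrite (_ : (fun M => _) = fun M : 'M[C]_2 => M 0 0 + M 1 1).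
  apply: cvgD; first exact: nbhs_filter.
    exact: (@coord_continuous C 2 2 0 0 M).
  exact: (@coord_continuous C 2 2 1 1 M).
by apply/funext => N; rewrite mxtrace22.
Qed.

(** A level set of a continuous function with finitely many values is the preimage of
   the complement of the finite set of its other values, which is closed. *)
Lemma open_trace_fiber (i : 'I_mu.+1) (S : set C) a : finite_set S ->
  (forall r : irr, S (\tr (irr_coords r i))) ->
  open ([set r | \tr (irr_coords r i) = a] : set (irr_space C mu p q)).
Proof.
move=> finS trS.
exists ((fun f : prod_topology (fun _ : 'I_mu.+1 => 'M[C]_2) => \tr (f i) : C^o)
          @^-1` ~` (S `\ a)).
  apply: open_comp.
    move=> f _; apply: continuous_comp; first exact: proj_continuous.
    exact: mxtrace_continuous.
  rewrite openC; have /accessible_finite_set_closed :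
      accessible_space C^o by apply: hausdorff_accessible; exact: norm_hausdorff.
  by apply; exact: finite_setD.
apply/seteqP; split=> r /=.
  by move=> h; apply: contrapT => ra; apply: h; split=> //; exact: trS.
by move=> -> [].
Qed.

(** The set U of representations with the same two traces as r0 is open and saturated
   for conjugation, so its image is open in the quotient. *)
Lemma local_constancy (r0 : irr) :
  \forall z \near char_class r0, forall r1 : irr, char_class r1 = z ->
    link_twisted_alexander r1 = link_twisted_alexander r0.
Proof.
pose U : set (irr_space C mu p q) :=
  [set r | \tr (X r) = \tr (X r0)] `&` [set r | \tr (Y r) = \tr (Y r0)].
have Uconj (r1 r2 : irr) : char_class r1 = char_class r2 -> U r1 -> U r2.
  move=> /eqmodP/asboolP[P hP] [].
  have conj_tr g : \tr (r2 g) = \tr (r1 g).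
    by rewrite hP /= mxtrace_mulC mulmxA mulVmx ?mul1mx // sl2_unit.
  by rewrite /U /= !conj_tr.
have openU : open U.
  apply: openI.
  - apply: (@open_trace_fiber (gen_x mu) _ _ (finite_order_traces_finite C p_gt0)).
    move=> r; have [e e2 [Xe _]] := irreducible_central_power (irr_homP (i := r)).
    exact: sl2_trace_finite Xe e2.
  - apply: (@open_trace_fiber (gen_y mu) _ _ (finite_order_traces_finite C q_gt0)).
    move=> r; have [e e2 [_ Ye]] := irreducible_central_power (irr_homP (i := r)).
    exact: sl2_trace_finite Ye e2.
have : nbhs (char_class r0) (@char_class C mu p q @` U).
  apply: open_nbhs_nbhs; split; last by exists r0.
  rewrite /open /= /quotient_open.
  rewrite (_ : _ @^-1` _ = U) //; apply/seteqP; split=> r.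
    by move=> [r' Ur'] /= E; apply: Uconj Ur'.
  by move=> Ur; exists r.
apply: filterS => z [r Ur <-] r1 E.
have [h1 h2] := Uconj _ _ (esym E) Ur.
exact: twisted_alexander_of_traces.
Qed.
End LocalConstancy.

(** * Eigenvalues exp(i pi a / n) *)

Section UnitCircle.
Variable R : realType.
Local Open Scope complex_scope.

Definition cis (x : R) : R[i] := cos x +i* sin x.

Lemma cisD x y : cis (x + y) = cis x * cis y.
Proof.
by rewrite /cis cosD sinD; apply/eqP; rewrite eq_complex /= !eqxx /= addrC eqxx.
Qed.

Lemma cis_mulrn x n : cis (x *+ n) = cis x ^+ n.
Proof.
elim: n => [|n IH]; first by rewrite /cis cos0 sin0.
by rewrite mulrS exprS cisD IH.
Qed.

Lemma cis_pi : cis pi = -1.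
Proof. by rewrite /cis cospi sinpi; apply/eqP; rewrite eq_complex /= oppr0 !eqxx. Qed.

Lemma exp_ipiE a n : exp_ipi R a n = cis (pi * a%:R / n%:R).
Proof.
rewrite /exp_ipi /cexp /cis /= !mul0r !mul1r sub0r oppr0 expR0 mul1r.
by rewrite add0r.
Qed.

Lemma exp_ipi_power a n : (0 < n)%N -> exp_ipi R a n ^+ n = (-1) ^+ a.
Proof.
move=> n0; rewrite exp_ipiE -cis_mulrn -[LHS]/(cis _) -cis_pi -cis_mulrn.
by congr cis; rewrite -[LHS]mulr_natr divfK ?pnatr_eq0 -?lt0n // mulr_natr.
Qed.
End UnitCircle.

Section DiagInv.
Variables (R : realType) (c : R[i]%C).
Hypothesis c0 : c != 0.

Lemma diag_inv_power n s :
  c ^+ n = (-1) ^+ s -> diag_inv c ^+ n = ((-1) ^+ s)%:M.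
Proof.
move=> cn; have -> k : diag_inv c ^+ k = diag_inv (c ^+ k).
  elim: k => [|k IH]; first by apply/matrixP => i j; rewrite !mxE invr1 if_same.
  rewrite exprS IH -[LHS]/(_ *m _) mulmx_diag; congr diag_mx.
  by apply/rowP => i; rewrite !mxE; case: eqP; rewrite exprS ?invfM.
by rewrite cn; apply/matrixP => i j; rewrite !mxE invr_sign if_same.
Qed.

Lemma simmx_power_trace n (X : 'M[R[i]%C]_2) s : c ^+ n = (-1) ^+ s ->
  X ~_{in unitmx} diag_inv c -> X ^+ n = ((-1) ^+ s)%:M /\ \tr X = c + c^-1.
Proof.
move=> cn [P Pu XD].
have PX : P *m X = diag_inv c *m P by apply/simmxP: XD.
have PXn k : P *m X ^+ k = diag_inv c ^+ k *m P.
  elim: k => [|k IH]; first by rewrite !expr0 mulmx1 mul1mx.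
  rewrite exprSr exprSr -[X ^+ k * _]/(_ *m _) -[_ ^+ k * _]/(_ *m _).
  by rewrite mulmxA IH -!mulmxA PX.
split.
  rewrite -[LHS](mulKmx Pu) PXn (diag_inv_power cn).
  by rewrite -scalar_mxC mulKmx.
have -> : X = invmx P *m (diag_inv c *m P) by rewrite -PX mulKmx.
by rewrite mxtrace_mulC -mulmxA mulmxV // mulmx1 mxtrace22 !mxE.
Qed.
End DiagInv.

Lemma sl2_charpoly_factor (K : fieldType) (a s : K) : a != 0 ->
  sl2_charpoly (a + a^-1) s = (s - a) * (s - a^-1).
Proof.
move=> a0; rewrite /sl2_charpoly mulrBr !mulrBl divff //; ring.
Qed.

Theorem theorem4p1 (R : realType) (mu p q : nat)
    (hmu : (1 <= mu)%N) (hp : (0 < p)%N) (hq : (0 < q)%N)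
    (hpq : coprime p q) :
  (forall (rho : {multiplicative link_group mu p q -> SL2 R[i]%C}) (a b : nat),
    irreducible_rep rho ->
    (a <= p)%N -> (b <= q)%N ->
    let alpha := exp_ipi R a p in
    let beta := exp_ipi R b q in
    sl2_mx (rho (link_x mu p q)) ~_{in unitmx} diag_inv alpha ->
    sl2_mx (rho (link_y mu p q)) ~_{in unitmx} diag_inv beta ->
    let t : ratfun R[i]%C mu := \prod_(k < mu) tvar R[i]%C k in
    let c := @ratfun_const R[i]%C mu in
    link_twisted_alexander rho =
      up_to_even_monomials
        ((t ^+ (p * q) - (-1) ^+ a) ^+ (2 * mu) /
         ((t ^+ p - c beta) * (t ^+ p - c beta^-1) *
          (t ^+ q - c alpha) * (t ^+ q - c alpha^-1)))) /\
  (forall rho0 : irr_rep R[i]%C mu p q,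
    \forall z \near char_class rho0,
      forall rho1 : irr_rep R[i]%C mu p q, char_class rho1 = z ->
        link_twisted_alexander rho1 = link_twisted_alexander rho0).
Proof.
case: mu hmu => // m _; split; last exact: local_constancy.
move=> rho a b _ _ _ alpha beta Xa Yb t c.
have ap : alpha ^+ p = (-1) ^+ a := exp_ipi_power R a hp.
have bq : beta ^+ q = (-1) ^+ b := exp_ipi_power R b hq.
have root0 (z : R[i]%C) n s : (0 < n)%N -> z ^+ n = (-1) ^+ s -> z != 0.
  move=> n0; apply: contra_eqN => /eqP ->.
  by rewrite expr0n gtn_eqF // eq_sym signr_eq0.
have a0 := root0 _ _ _ hp ap; have b0 := root0 _ _ _ hq bq.
have [Xp trX] := simmx_power_trace ap Xa.
have [_ trY] := simmx_power_trace bq Yb.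
have e2 : ((-1) ^+ a : R[i]%C) ^+ 2 = 1 by rewrite sqrr_sign.
have factor z s : z != 0 ->
    sl2_charpoly (c (z + z^-1)) s = (s - c z) * (s - c z^-1).
  move=> z0; rewrite /c rmorphD /= [ratfun_const _ z^-1]fmorphV /=.
  by apply: sl2_charpoly_factor; rewrite fmorph_eq0.
rewrite /link_twisted_alexander.
rewrite (link_twisted_alexander_traces hp hq (@gmulfM _ _ rho) e2 Xp) trX trY.
by rewrite (factor _ _ a0) (factor _ _ b0) /c rmorph_sign mulrA.
Qed.
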